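(* Let $K$ be a field with a non-trivial valuation $v$, and let $A(x)=\sum_{i=0}^n a_ix^i\in K[x]$ be a polynomial of degree $n$. Assume that the characteristic of the residue field of $v$ does not divide $n$. If the orbit $A(x)GL(2,K)$ contains an Eisenstein–Dumas polynomial at $v$, then at least one of the following holds: $U(A(x))=A\big(x-\frac{a_{n-1}}{na_n}\big)$ is an Eisenstein–Dumas polynomial at $v$; or $a_0\ne 0$ and $L(A(x))=\big(1-\frac{a_1}{na_0}x\big)^nA\big(\frac{x}{1-\frac{a_1}{na_0}x}\big)$ is an Eisenstein–Dumas polynomial at $v$; or there is $t\in K$ with $A'(t)\neq 0$ such that the polynomial $$A(x)\begin{pmatrix}t&\phi(t)\\1&1\end{pmatrix}=(x+1)^nA\Big(\frac{tx+\phi(t)}{x+1}\Big),\qquad \phi(t)=t-n\frac{A(t)}{A'(t)},$$ is an Eisenstein–Dumas polynomial at $v$. Here $A'$ denotes the derivative of $A$.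
   Context: $v:K\to\Gamma\cup\{\infty\}$ is a non-trivial Krull valuation with values in a linearly ordered abelian group $\Gamma$ ($v(a)=\infty$ iff $a=0$, $v(ab)=v(a)+v(b)$, $v(a+b)\ge\min\{v(a),v(b)\}$); $K$ is not assumed henselian; the residue field is $R_v/M_v$ with $R_v=\{v\ge0\}$, $M_v=\{v>0\}$. Action of $GL(2,K)$: for $A$ of degree $n$ and $g=\begin{pmatrix}a&b\\c&d\end{pmatrix}$, $A(x)g=(cx+d)^nA\big(\frac{ax+b}{cx+d}\big)$, regarded as a polynomial of formal degree $n$ (written $\sum_{i=0}^n b_ix^i$, $b_n$ possibly $0$); the orbit $A(x)GL(2,K)$ is the set of all $A(x)g$. A polynomial written $\sum_{i=0}^n b_ix^i$ is Eisenstein–Dumas at $v$ if (D0) $b_0b_n\neq0$; (D1) $v(b_0)-v(b_n)\notin k\Gamma=\{kg:g\in\Gamma\}$ for every integer $k>1$ dividing $n$; (D2) $nv(b_i)\ge (n-i)v(b_0)+iv(b_n)$ for $0\le i\le n$.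
   Formalization: The degree n is assumed to be at least 2; for n = 1 the claim is false, e.g. A = x+1 is Eisenstein–Dumas (D1 is vacuous), but U(A) and the third polynomial have zero constant term and L(A) has zero coefficient of x. *)

(* Defs.v *)
From HB Require Import structures.
From mathcomp Require Import all_boot all_order all_algebra.

Set Implicit Arguments.
Unset Strict Implicit.
Unset Printing Implicit Defensive.

Import Order.TTheory GRing.Theory Num.Theory.
Local Open Scope ring_scope.

HB.mixin Record POrderedZmodule_isOrderedZmodule G
    of Num.POrderedZmodule G := {
  ozmod_total : total (<=%R : rel G);
  ozmod_leD2l : forall z x y : G, x <= y -> z + x <= z + y
}.

(* Linearly ordered abelian groups.  Totality is part of the mixin: a join with
   Order.Total would have to be declared before Num.RealDomain. *)
#[short(type="orderedZmodType")]
HB.structure Definition OrderedZmodule :=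
  { G of Num.POrderedZmodule G & POrderedZmodule_isOrderedZmodule G }.

(* The set G \cup {oo} is encoded as option G, with oo = None. *)
Section ExtendedGroup.
Variable G : orderedZmodType.
Implicit Types (x y : option G) (k : nat).

Definition vle x y : bool :=
  match x, y with
  | _, None => true
  | None, Some _ => false
  | Some a, Some b => a <= b
  end.

Definition vlt x y : bool :=
  match x, y with
  | None, _ => false
  | Some _, None => true
  | Some a, Some b => a < b
  end.

Definition vmin x y : option G := if vle x y then x else y.

Definition vadd x y : option G :=
  match x, y with
  | Some a, Some b => Some (a + b)
  | _, _ => None
  end.

(* Multiplication by k, with k oo = oo, including k = 0. *)
Definition vmul k x : option G := omap (fun a => a *+ k) x.

End ExtendedGroup.

Record valuation (K : fieldType) (G : orderedZmodType) := Valuation {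
  val_fun :> K -> option G;
  val_eq0 : forall a, val_fun a = None <-> a = 0;
  valM : forall a b, val_fun (a * b) = vadd (val_fun a) (val_fun b);
  valD : forall a b,
    vle (vmin (val_fun a) (val_fun b)) (val_fun (a + b))
}.

Definition nontrivial_valuation (K : fieldType) (G : orderedZmodType)
    (v : valuation K G) : Prop :=
  exists2 a : K, a != 0 & v a <> Some 0.

Section ResidueField.
Variables (K : fieldType) (G : orderedZmodType) (v : valuation K G).

Definition val_ring : {pred K} := fun a => vle (Some 0) (v a).

Lemma val_finite a : a != 0 -> exists g, v a = Some g.
Proof.
by move=> /eqP na; case E: (v a) => [g|]; [exists g | case: na; apply/(val_eq0 v)].
Qed.

Lemma val0 : v 0 = None.
Proof. exact/val_eq0. Qed.

Lemma val1 : v 1 = Some 0.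
Proof.
have [g E] := val_finite (oner_neq0 K).
have := valM v 1 1; rewrite mulr1 E /= => -[] /(congr1 (fun x => x - g)).
by rewrite subrr addrK => <-.
Qed.

Lemma valN1 : v (-1) = Some 0.
Proof.
have [g E]: exists g, v (-1) = Some g by apply: val_finite; rewrite oppr_eq0 oner_neq0.
have := valM v (-1) (-1); rewrite mulrNN mulr1 val1 E /= => -[] g2.
congr Some; apply/eqP; rewrite eq_le.
have /orP[g0|g0] := ozmod_total g 0.
  by have := ozmod_leD2l g _ _ g0; rewrite -g2 addr0 g0 => ->.
by have := ozmod_leD2l g _ _ g0; rewrite -g2 addr0 g0 andbT => ->.
Qed.

Lemma valN a : v (- a) = v a.
Proof.
by rewrite -mulN1r valM valN1; case: (v a) => //= g; rewrite add0r.
Qed.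

Lemma vadd_ge0 (x y : option G) :
  vle (Some 0) x -> vle (Some 0) y -> vle (Some 0) (vadd x y).
Proof.
case: x y => [x|] [y|] //= x0 y0; apply: le_trans x0 _.
by have := ozmod_leD2l x _ _ y0; rewrite addr0.
Qed.

Lemma vadd_gt0 (x y : option G) :
  vle (Some 0) x -> vlt (Some 0) y -> vlt (Some 0) (vadd x y).
Proof.
case: x y => [x|] [y|] //= x0 y0.
apply: lt_le_trans y0 _.
by have := ozmod_leD2l y _ _ x0; rewrite addr0 addrC.
Qed.

Lemma vle_trans (y x z : option G) : vle x y -> vle y z -> vle x z.
Proof. by case: x y z => [x|] [y|] [z|] //=; apply: le_trans. Qed.

Lemma vlt_le_trans (y x z : option G) : vlt x y -> vle y z -> vlt x z.
Proof. by case: x y z => [x|] [y|] [z|] //=; apply: lt_le_trans. Qed.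

Lemma val_ring_subring : subring_closed val_ring.
Proof.
split=> [|a b|a b]; rewrite /in_mem /= /val_ring; first by rewrite val1 /=.
  move=> a0 b0; apply: vle_trans (valD v a (- b)).
  by rewrite /vmin valN; case: ifP.
by rewrite valM; apply: vadd_ge0.
Qed.

HB.instance Definition _ :=
  GRing.isSubringClosed.Build K val_ring val_ring_subring.

Record val_ring_type := ValRing { vr_val :> K; _ : vr_val \in val_ring }.

HB.instance Definition _ := [isSub for vr_val].
HB.instance Definition _ := [Choice of val_ring_type by <:].
HB.instance Definition _ :=
  [SubChoice_isSubComNzRing of val_ring_type by <:].

Definition val_ideal : {pred val_ring_type} := fun a => vlt (Some 0) (v (val a)).

Lemma val_ideal_closed : idealr_closed val_ideal.
Proof.
split; rewrite /in_mem /= /val_ideal.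
- by rewrite rmorph0 val0.
- by rewrite rmorph1 val1 /= ltxx.
- move=> a b c b0 c0.
  change (vlt (Some 0) (v (val a * val b + val c))).
  have ab0 : vlt (Some 0) (v (val a * val b)).
    by rewrite valM; apply: vadd_gt0 => //; exact: (valP a).
  apply: (vlt_le_trans _ (valD v _ _)); rewrite /vmin; by case: ifP.
Qed.

HB.instance Definition _ :=
  isIdealr.Build val_ring_type val_ideal val_ideal_closed.

Definition residue_field := {ideal_quot val_ideal}.

Lemma residue_field_inv (x : residue_field) :
  x != 0 -> exists y : residue_field, y * x = 1.
Proof.
have -> : x = (\pi_residue_field)%qT (repr x) by rewrite reprK.
set a := repr x => nz.
have va0 : v (val a) = Some 0.
  have := valP a; rewrite /in_mem /= /val_ring.
  have : ~~ val_ideal a.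
    apply: contra nz => a0.
    rewrite -[0](rmorph0 (\pi_residue_field)%qT) -Quotient.idealrBE subr0.
    exact: a0.
  rewrite /val_ideal; case: (v (val a)) => //= g.
  by rewrite lt_neqAle => + g0; rewrite g0 andbT negbK => /eqP <-.
have na : val a != 0 by apply: contra_eq_neq va0 => ->; rewrite val0.
have vb : (val a)^-1 \in val_ring.
  have := valM v (val a)^-1 (val a); rewrite mulVf // val1 va0.
  rewrite /in_mem /= /val_ring; case: (v _) => //= g [].
  by rewrite addr0 => <-.
exists ((\pi_residue_field)%qT (ValRing vb)).
rewrite -rmorphM -(rmorph1 (\pi_residue_field)%qT); congr ((\pi_residue_field)%qT _).
by apply: val_inj; rewrite rmorphM rmorph1 /= mulVf.
Qed.

End ResidueField.

Section Action.
Variables (K : fieldType) (n : nat).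
Implicit Types (A P Q : {poly K}) (g : 'M[K]_2).

(* Q^n A(P/Q), for A of formal degree n; see homogenizationE. *)
Definition homogenization A P Q : {poly K} :=
  \sum_(i < n.+1) A`_i *: (P ^+ i * Q ^+ (n - i)).

Lemma homogenizationE A P Q : (size A <= n.+1)%N -> Q != 0 ->
  tofrac (homogenization A P Q) =
  tofrac Q ^+ n * (map_poly (fun c => tofrac c%:P) A).[tofrac P / tofrac Q].
Proof.
move=> sA Q0; have tQ : tofrac Q != 0 by rewrite tofrac_eq0.
have sB : (size (map_poly (fun c => tofrac c%:P) A) <= n.+1)%N.
  exact: leq_trans (size_poly _ _) sA.
rewrite (horner_coef_wide _ sB) mulr_sumr rmorph_sum /=.
apply: eq_bigr => i _; have lein : (i <= n)%N by rewrite -ltnS.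
rewrite -mul_polyC !rmorphM !rmorphXn /=.
rewrite coef_map_id0 ?rmorph0 // expr_div_n.
have -> : tofrac Q ^+ n = tofrac Q ^+ (n - i) * tofrac Q ^+ i.
  by rewrite -exprD subnK.
rewrite [RHS]mulrCA; congr (_ * _).
rewrite -mulrA [tofrac Q ^+ i * _]mulrCA divff ?expf_neq0 // mulr1.
by rewrite mulrC.
Qed.

Definition mx22 (a b c d : K) : 'M[K]_2 :=
  \matrix_(i, j) if i == 0 then (if j == 0 then a else b)
                 else (if j == 0 then c else d).

Definition GL2_act A g : {poly K} :=
  homogenization A ((g 0 0)%:P * 'X + (g 0 1)%:P)
                   ((g 1 0)%:P * 'X + (g 1 1)%:P).

Definition GL2_orbit A (B : {poly K}) : Prop :=
  exists2 g, g \in unitmx & B = GL2_act A g.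

Definition transform_U A : {poly K} := A \Po ('X - (A`_n.-1 / (n%:R * A`_n))%:P).

Definition transform_L A : {poly K} :=
  homogenization A 'X (1 - (A`_1 / (n%:R * A`_0))%:P * 'X).

Definition phi A (t : K) : K := t - n%:R * (A.[t] / A^`().[t]).

End Action.

(* B is regarded as a polynomial of formal degree n.  In the third clause the
   values of B`_0 and B`_n are finite by the second one. *)
Definition eisenstein_dumas (K : fieldType) (G : orderedZmodType)
    (v : valuation K G) (n : nat) (B : {poly K}) : Prop :=
  [/\ (size B <= n.+1)%N,
      B`_0 * B`_n != 0,
      forall g0 gn : G, v B`_0 = Some g0 -> v B`_n = Some gn ->
        forall k : nat, (1 < k)%N -> (k %| n)%N ->
          ~ exists g : G, g0 - gn = g *+ k
    & forall i : nat, (i <= n)%N ->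
        vle (vadd (vmul (n - i) (v B`_0)) (vmul i (v B`_n)))
            (vmul n (v B`_i))].

(* Main.v *)
(* Being Eisenstein-Dumas is preserved by x -> r x, by reversal, and by the
   translations x -> x + s with n v(s) >= v(b_0) - v(b_n).  As v(n) = 0, the
   translation which kills b_(n-1) is one of them.  Hence some B = A g in the
   orbit is Eisenstein-Dumas with b_(n-1) = 0, which means that g maps 0 to the
   polar point of g(oo).  If g(oo) = oo, this polar point is the barycentre of
   the roots and B is U(A) up to scaling.  If g(oo) = t is finite, the polar
   point is phi(t): when A'(t) <> 0, B is the third polynomial up to scaling;
   when A'(t) = 0, phi(t) = oo, B is up to scaling the reversal of A(x + t), so
   A(x + t) is Eisenstein-Dumas and recentring it gives U(A).  The polynomial
   L(A) corresponds to t = 0, which the last two cases cover. *)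
Require Import Defs.
From HB Require Import structures.
From mathcomp Require Import all_boot all_order all_algebra.
From mathcomp Require Import ring.

Set Implicit Arguments.
Unset Strict Implicit.
Unset Printing Implicit Defensive.

Import Order.TTheory GRing.Theory Num.Theory.
Local Open Scope ring_scope.

Lemma det_mx2 (R : comNzRingType) (M : 'M[R]_2) :
  \det M = M 0 0 * M 1 1 - M 0 1 * M 1 0.
Proof.
rewrite (expand_det_row _ 0) !big_ord_recl big_ord0 addr0 /cofactor !det_mx11.
rewrite !mxE /= expr0 expr1 mul1r mulN1r mulrN.
by congr (M _ _ * M _ _ - M _ _ * M _ _); apply/val_inj.
Qed.

(** * Inequalities in a linearly ordered abelian group *)

Section OrderedZmodule.
Variable G : orderedZmodType.
Implicit Types (g h : G) (k m n : nat).

Lemma ozmod_leD g1 h1 g2 h2 : g1 <= h1 -> g2 <= h2 -> g1 + g2 <= h1 + h2.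
Proof.
move=> le1 le2; apply: le_trans (ozmod_leD2l g1 _ _ le2) _.
by rewrite ![_ + h2]addrC; apply: ozmod_leD2l.
Qed.

Lemma ozmod_ltD g1 h1 g2 h2 : g1 < h1 -> g2 <= h2 -> g1 + g2 < h1 + h2.
Proof.
move=> lt1 le2; rewrite lt_neqAle (ozmod_leD (ltW lt1) le2) andbT.
apply: contraTneq lt1 => eq12.
have := ozmod_leD2l (h1 - g2) _ _ le2.
by rewrite subrK addrAC -eq12 addrK => /le_gtF ->.
Qed.

Lemma ozmod_leMn n g h : g <= h -> g *+ n <= h *+ n.
Proof.
by move=> le_gh; elim: n => // n IHn; rewrite !mulrS; apply: ozmod_leD.
Qed.

Lemma ozmod_ltNge g h : (g < h) = ~~ (h <= g).
Proof.
have /orP[le_gh|le_hg] := ozmod_total g h; last by rewrite le_hg le_gtF.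
by rewrite lt_neqAle le_gh andbT; congr (~~ _); rewrite eq_le le_gh.
Qed.

Lemma ozmod_ltMn2r n g h : g *+ n < h *+ n -> g < h.
Proof.
by rewrite !ozmod_ltNge; apply: contra; apply: ozmod_leMn.
Qed.

End OrderedZmodule.

(** * Bounds on multiples of a valuation *)

Section ScaledValuation.
Variables (K : fieldType) (G : orderedZmodType) (v : valuation K G).
Implicit Types (x y : option G) (a b : K) (g h : G).

Lemma vmulD n x y : vmul n (vadd x y) = vadd (vmul n x) (vmul n y).
Proof. by case: x y => [g|] [h|] //=; rewrite mulrnDl. Qed.

(** The bound is put on n v(a), since the natural bound h / n on v(a) need not lie in the value
    group. These predicates express (D2), whose slope is d / n. *)
Definition vmul_ge n h : {pred K} := fun a => vle (Some h) (vmul n (v a)).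
Definition vmul_gt n h : {pred K} := fun a => vlt (Some h) (vmul n (v a)).

Lemma vmul_ge0 n h : 0 \in vmul_ge n h.
Proof. by rewrite unfold_in /vmul_ge Defs.val0. Qed.

Lemma vmul_gt0 n h : 0 \in vmul_gt n h.
Proof. by rewrite unfold_in /vmul_gt Defs.val0. Qed.

Lemma vmul_geD n h a b :
  a \in vmul_ge n h -> b \in vmul_ge n h -> a + b \in vmul_ge n h.
Proof.
rewrite !unfold_in /vmul_ge => ha hb.
apply: (@vle_trans _ (vmul n (vmin (v a) (v b)))).
  by rewrite /vmin; case: ifP.
have := Defs.valD v a b.
by case: vmin (v (a + b)) => [?|] [?|] //=; apply: ozmod_leMn.
Qed.

Lemma vmul_gtD n h a b :
  a \in vmul_gt n h -> b \in vmul_gt n h -> a + b \in vmul_gt n h.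
Proof.
rewrite !unfold_in /vmul_gt => ha hb.
apply: (@vlt_le_trans _ (vmul n (vmin (v a) (v b)))).
  by rewrite /vmin; case: ifP.
have := Defs.valD v a b.
by case: vmin (v (a + b)) => [?|] [?|] //=; apply: ozmod_leMn.
Qed.

Lemma vmul_gtW n h a : a \in vmul_gt n h -> a \in vmul_ge n h.
Proof. by rewrite !unfold_in /vmul_ge /vmul_gt; case: vmul => //= g /ltW. Qed.

Lemma vmul_geM n h1 h2 a b :
  a \in vmul_ge n h1 -> b \in vmul_ge n h2 -> a * b \in vmul_ge n (h1 + h2).
Proof.
rewrite !unfold_in /vmul_ge Defs.valM vmulD.
by case: (vmul n (v a)) (vmul n (v b)) => [?|] [?|] //=; apply: ozmod_leD.
Qed.

Lemma vmul_gtM n h1 h2 a b :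
  a \in vmul_gt n h1 -> b \in vmul_ge n h2 -> a * b \in vmul_gt n (h1 + h2).
Proof.
rewrite !unfold_in /vmul_ge /vmul_gt Defs.valM vmulD.
by case: (vmul n (v a)) (vmul n (v b)) => [?|] [?|] //=; apply: ozmod_ltD.
Qed.

Lemma vmul_geX n h a k : a \in vmul_ge n h -> a ^+ k \in vmul_ge n (h *+ k).
Proof.
move=> ha; elim: k => [|k IHk]; last by rewrite exprS mulrS vmul_geM.
by rewrite unfold_in /vmul_ge expr0 Defs.val1 /= mul0rn.
Qed.

Lemma vmul_gtX n h a k :
  (0 < k)%N -> a \in vmul_gt n h -> a ^+ k \in vmul_gt n (h *+ k).
Proof.
case: k => // k _ ha; rewrite exprS mulrS vmul_gtM //.
by rewrite vmul_geX // vmul_gtW.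
Qed.

Lemma vmul_geMn n h a k : a \in vmul_ge n h -> a *+ k \in vmul_ge n h.
Proof.
move=> ha; elim: k => [|k IHk]; first exact: vmul_ge0.
by rewrite mulrS vmul_geD.
Qed.

Lemma vmul_ge_Some n g a : v a = Some g -> a \in vmul_ge n (g *+ n).
Proof. by rewrite unfold_in /vmul_ge => -> /=. Qed.

Lemma valuationX g a k : v a = Some g -> v (a ^+ k) = Some (g *+ k).
Proof.
move=> va; elim: k => [|k IHk]; first exact: Defs.val1.
by rewrite exprS Defs.valM va IHk mulrS.
Qed.

Lemma valuationV g a : v a = Some g -> v a^-1 = Some (- g).
Proof.
move=> va; have a0 : a != 0 by apply: contra_eq_neq va => ->; rewrite Defs.val0.
have := Defs.valM v a a^-1; rewrite divff // Defs.val1 va.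
case: (v a^-1) => //= h [].
by move/esym/eqP; rewrite addrC addr_eq0 => /eqP ->.
Qed.

(** The ultrametric inequality bounds v(a + b) from below; applied to a = (a + b) - b, it also
    bounds it from above. *)
Lemma valD_gt n g a b :
  v a = Some g -> b \in vmul_gt n (g *+ n) -> v (a + b) = Some g.
Proof.
move=> va; rewrite unfold_in /vmul_gt => gt_b.
have {}gt_b : vlt (Some g) (v b).
  by move: gt_b; case: (v b) => //= h; apply: ozmod_ltMn2r.
have := Defs.valD v a b; have := Defs.valD v (a + b) (- b).
rewrite Defs.valN addrK va /vmin.
have -> : vle (Some g) (v b) by move: gt_b; case: (v b) => //= h /ltW.
move: gt_b; case: (v b) (v (a + b)) => [b'|] [h|] //=.
- rewrite ozmod_ltNge; case: ifP => _ /negbTE gt_b' /=.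
    by move=> le_hg le_gh; congr Some; apply: le_anti; rewrite le_hg.
  by rewrite gt_b'.
- by rewrite ozmod_ltNge => /negbTE ->.
- by move=> _ le_hg le_gh; congr Some; apply: le_anti; rewrite le_hg.
Qed.

End ScaledValuation.

(** Strong induction, splitting off the smallest prime factor p. If v(p) were positive, p would
    vanish in the residue field, whose characteristic would then be a prime dividing n. *)
Lemma val_natr (K : fieldType) (G : orderedZmodType) (v : valuation K G) n :
    (0 < n)%N ->
    (forall p : nat, p \in [pchar residue_field v] -> ~~ (p %| n)%N) ->
  v n%:R = Some 0.
Proof.
elim/ltn_ind: n => n IHn n_gt0 charn.
have [n1|n_gt1] := leqP n 1.
  have -> : n = 1%N by apply/eqP; rewrite eqn_leq n1.
  by rewrite Defs.val1.
pose p := pdiv n; have p_pr : prime p by apply: pdiv_prime.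
have p_n : (p %| n)%N by apply: pdiv_dvd.
have vp : v p%:R = Some 0.
  have pR : p%:R \in val_ring v by rewrite rpred_nat.
  have pE : ValRing pR = p%:R by apply: val_inj; rewrite rmorph_nat.
  apply: contraTeq p_n => vp; apply: charn.
  have pM : ValRing pR \in @val_ideal K G v.
    move: (pR) vp; rewrite /in_mem /= /val_ring /val_ideal /=.
    case: (v _) => //= g; rewrite lt_def => -> /eqP g0; rewrite andbT.
    by apply: contra_not_neq g0 => ->.
  have piE : (\pi_(residue_field v))%qT (ValRing pR) = p%:R.
    by rewrite pE rmorph_nat.
  have pi0 : (\pi_(residue_field v))%qT (ValRing pR) = 0.
    rewrite -(rmorph0 (\pi_(residue_field v))%qT); apply/eqP.
    have := @Quotient.idealrBE _ (@val_ideal K G v) (ValRing pR) 0.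
    by rewrite subr0 pM; move/esym.
  by rewrite inE p_pr /= -piE pi0.
have vm : v (n %/ p)%:R = Some 0.
  apply: IHn; first by rewrite ltn_Pdiv ?prime_gt1.
    by rewrite divn_gt0 ?prime_gt0 // dvdn_leq.
  by move=> q /charn; apply: contra => /dvdn_trans; apply; apply: dvdn_div.
have -> : n%:R = (n %/ p)%:R * p%:R :> K by rewrite -natrM divnK.
by rewrite Defs.valM vm vp /= addr0.
Qed.

(** * Coefficients of translates and of homogenizations at linear forms *)

Section LinearForms.
Variable K : fieldType.
Implicit Types (A B : {poly K}) (a b c d e r t : K) (n i j k m : nat).

(** The binomial formula needs no bound on k: for k > m the truncated subtraction is harmless,
    because the binomial coefficient is 0. *)
Lemma coef_linear_exp c d m k :
  ((c%:P * 'X + d%:P) ^+ m)`_k = c ^+ k * d ^+ (m - k) *+ 'C(m, k).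
Proof.
rewrite addrC exprDn coef_sum.
under eq_bigr => i _ do
  rewrite exprMn -!rmorphXn /= mulrA -rmorphM /= coefMn coefCM coefXn.
have [le_km|lt_mk] := leqP k m.
  rewrite (bigD1 (Ordinal (le_km : (k < m.+1)%N))) //= big1 ?addr0.
    by rewrite eqxx mulr1 mulrC.
  move=> i /negPf ne_ik; rewrite [_ == _]eq_sym.
  by rewrite -val_eqE /= in ne_ik; rewrite ne_ik mulr0 mul0rn.
rewrite bin_small // mulr0n big1 // => i _.
by rewrite gtn_eqF ?mulr0 ?mul0rn // (leq_ltn_trans _ lt_mk) // -ltnS.
Qed.

Lemma coef_comp_XaddC n A r k : (size A <= n.+1)%N ->
  (A \Po ('X + r%:P))`_k = \sum_(i < n.+1) A`_i * (r ^+ (i - k) *+ 'C(i, k)).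
Proof.
move=> sA; rewrite -[X in X + _]mul1r -[1]/(1%:P).
rewrite comp_polyE.
rewrite (big_ord_widen _ (fun i => A`_i *: ((1%:P * 'X + r%:P) ^+ i)) sA).
rewrite coef_sum big_mkcond /=; apply: eq_bigr => i _.
case: ltnP => [_|le_Ai]; first by rewrite coefZ coef_linear_exp expr1n mul1r.
by rewrite nth_default ?mul0r.
Qed.

Lemma size_comp_XaddC n A r :
  (size A <= n.+1)%N -> (size (A \Po ('X + r%:P)) <= n.+1)%N.
Proof. by rewrite size_comp_poly2 ?size_XaddC. Qed.

Lemma comp_XaddC_lead n A r : (size A <= n.+1)%N ->
  (A \Po ('X + r%:P))`_n = A`_n.
Proof.
move=> sA; rewrite (coef_comp_XaddC _ _ sA) big_ord_recr /= big1 ?add0r.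
  by rewrite subnn binn mulr1.
by move=> i _; rewrite bin_small ?mulr0.
Qed.

Lemma comp_XaddC_sublead n A r : (0 < n)%N -> (size A <= n.+1)%N ->
  (A \Po ('X + r%:P))`_n.-1 = A`_n.-1 + A`_n * (r *+ n).
Proof.
case: n => // n _ sA.
rewrite (coef_comp_XaddC _ _ sA) !big_ord_recr /= big1 ?add0r.
  by rewrite subnn binn mulr1 subSnn binSn.
by move=> i _; rewrite bin_small ?mulr0.
Qed.

Lemma coef0_comp_XaddC A r : (A \Po ('X + r%:P))`_0 = A.[r].
Proof. by rewrite -horner_coef0 horner_comp !hornerE. Qed.

Lemma coef1_comp_XaddC A r : (A \Po ('X + r%:P))`_1 = A^`().[r].
Proof.
rewrite -[LHS]mulr1n -(coef_deriv (A \Po _)) deriv_comp.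
by rewrite derivD derivX derivC addr0 mulr1 coef0_comp_XaddC.
Qed.

Lemma homogenization_comp n A B P Q :
  homogenization n A P Q \Po B = homogenization n A (P \Po B) (Q \Po B).
Proof.
rewrite /homogenization raddf_sum; apply: eq_bigr => i _ /=.
by rewrite comp_polyZ comp_polyM !rmorphXn.
Qed.

(** Formally this is A(P/Q + t), the Taylor expansion at t. Expanding (P + tQ)^i and exchanging the
    sums avoids the quotient, so that Q may be any polynomial. *)
Lemma homogenization_shift n A t P Q : (size A <= n.+1)%N ->
  homogenization n A (P + t%:P * Q) Q =
  homogenization n (A \Po ('X + t%:P)) P Q.
Proof.
move=> sA; rewrite /homogenization.
under [RHS]eq_bigr => k _ do rewrite (coef_comp_XaddC _ _ sA) scaler_suml.
rewrite exchange_big /=; apply: eq_bigr => i _.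
have le_in : (i <= n)%N by rewrite -ltnS.
rewrite addrC exprDn mulr_suml scaler_sumr.
rewrite (big_ord_widen _ (fun k : nat => A`_i *:
  ((t%:P * Q) ^+ (i - k) * P ^+ k *+ 'C(i, k) * Q ^+ (n - i))) (ltn_ord i)).
rewrite big_mkcond; apply: eq_bigr => k _; case: ltnP => [le_ki|lt_ik]; last first.
  by rewrite bin_small ?mulr0n ?mulr0 ?scale0r.
rewrite -scalerA; congr (_ *: _).
rewrite mulrnAl -scalerMnl; congr (_ *+ _).
rewrite exprMn -rmorphXn /= -!mulrA mul_polyC; congr (_ *: _).
rewrite mulrCA -exprD; congr (_ * _ ^+ _).
by rewrite addnC addnBA // subnK.
Qed.

(** A constant numerator e means that, for c nonzero, the homography maps oo to 0. This is the
    general shape once g(oo) has been translated to 0. *)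
Lemma coef_homogenizationC n A e c d k :
  (homogenization n A e%:P (c%:P * 'X + d%:P))`_k =
  \sum_(i < n.+1) A`_i * e ^+ i * (c ^+ k * d ^+ (n - i - k) *+ 'C(n - i, k)).
Proof.
rewrite coef_sum; apply: eq_bigr => i _.
by rewrite coefZ -rmorphXn /= coefCM coef_linear_exp mulrA.
Qed.

Lemma size_homogenizationC n A e c d :
  (size (homogenization n A e%:P (c%:P * 'X + d%:P)) <= n.+1)%N.
Proof.
apply/leq_sizeP => k lt_nk; rewrite coef_homogenizationC big1 // => i _.
by rewrite bin_small ?mulr0 // (leq_ltn_trans (leq_subr _ _) lt_nk).
Qed.

End LinearForms.

(** * Operations that preserve the Eisenstein-Dumas property *)

Section EisensteinDumas.
Variables (K : fieldType) (G : orderedZmodType) (v : valuation K G) (n : nat).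
Implicit Types (A B C : {poly K}) (a r s : K) (g d : G).

(* [d] is the difference v(b_0) - v(b_n), so that (D2) says that
   n v(b_i) >= n v(b_0) - i d. *)
Lemma eisenstein_dumasP B : eisenstein_dumas v n B <->
  (size B <= n.+1)%N /\ exists g d,
    [/\ v B`_0 = Some g, v B`_n = Some (g - d),
        forall k, (1 < k)%N -> (k %| n)%N -> forall h, d <> h *+ k
      & forall i, (i <= n)%N -> B`_i \in vmul_ge v n (g *+ n - d *+ i)].
Proof.
have D2E g d i : (i <= n)%N -> g *+ (n - i) + (g - d) *+ i = g *+ n - d *+ i.
  by move=> le_in; rewrite mulrnBl addrA -mulrnDr subnK.
split=> [[sB nz D1 D2]|[sB [g [d [v0 vn D1 D2]]]]].
  move: nz; rewrite mulf_eq0 negb_or => /andP[].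
  move=> /(val_finite v)[g v0] /(val_finite v)[h vn].
  split=> //; exists g, (g - h); rewrite subKr; split=> // [k k1 kn f gh|i le_in].
    by apply: (D1 g h v0 vn k) => //; exists f.
  by have := D2 i le_in; rewrite v0 vn /= unfold_in -D2E ?subKr.
split=> // [|g0 gn|i le_in].
- rewrite mulf_eq0 negb_or; apply/andP; split.
    by apply: contra_eq_neq v0 => ->; rewrite Defs.val0.
  by apply: contra_eq_neq vn => ->; rewrite Defs.val0.
- rewrite v0 vn => -[<-] [<-] k k1 kn [h]; rewrite subKr; exact: D1.
- by rewrite v0 vn /= D2E //; exact: D2.
Qed.

(** Passing from B(x) to a B(r x) lowers d by n v(r), which is a multiple of every k dividing n, so
    (D1) survives; both sides of (D2) at i grow by the same amount n v(a) + n i v(r). *)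
Lemma eisenstein_dumas_scale B C a r : a != 0 -> r != 0 ->
    (size C <= n.+1)%N ->
    (forall i, (i <= n)%N -> C`_i = a * r ^+ i * B`_i) ->
  eisenstein_dumas v n B -> eisenstein_dumas v n C.
Proof.
move=> /(val_finite v)[m va] /(val_finite v)[l vr] sC CE.
move=> /eisenstein_dumasP[sB [g [d [v0 vn D1 D2]]]].
apply/eisenstein_dumasP; split=> //; exists (m + g), (d - l *+ n).
split=> [||k k1 kn h dE|i le_in].
- by rewrite CE // expr0 mulr1 Defs.valM va v0.
- rewrite CE // !Defs.valM va (valuationX _ vr) vn /=.
  by congr Some; rewrite opprB addrACA addrA.
- apply: (D1 k k1 kn (h + l *+ (n %/ k))).
  by rewrite mulrnDl -mulrnA divnK // -dE subrK.
- have -> : (m + g) *+ n - (d - l *+ n) *+ i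
      = m *+ n + (l *+ i) *+ n + (g *+ n - d *+ i).
    rewrite mulrnDl mulrnBl opprB -!mulrnA mulnC addrACA -!addrA.
    by congr (_ + _); rewrite addrCA.
  rewrite CE //; apply: vmul_geM (D2 _ le_in).
  apply: vmul_geM; first exact: vmul_ge_Some.
  by apply: vmul_ge_Some; apply: valuationX.
Qed.

(** Reversal turns d into -d and exchanges the inequalities (D2) at i and n - i. *)
Lemma eisenstein_dumas_rev B C :
    (size C <= n.+1)%N -> (forall i, (i <= n)%N -> C`_i = B`_(n - i)) ->
  eisenstein_dumas v n B -> eisenstein_dumas v n C.
Proof.
move=> sC CE /eisenstein_dumasP[sB [g [d [v0 vn D1 D2]]]].
apply/eisenstein_dumasP; split=> //; exists (g - d), (- d).
split=> [||k k1 kn h dE|i le_in].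
- by rewrite CE // subn0.
- by rewrite CE // subnn v0 opprK subrK.
- by apply: (D1 k k1 kn (- h)); rewrite mulNrn -dE opprK.
- rewrite CE //; have := D2 (n - i)%N (leq_subr _ _).
  by rewrite mulrnBr // mulrnBl mulNrn !opprB opprK addrA addrAC.
Qed.

Lemma eisenstein_dumas_neq0 B : eisenstein_dumas v n B ->
  B`_0 != 0 /\ B`_n != 0.
Proof. by case=> _; rewrite mulf_eq0 negb_or => /andP. Qed.

Hypotheses (n_gt1 : (1 < n)%N) (vn0 : v n%:R = Some 0).

(* With d = v(b_0) - v(b_n), the bound n v(s) >= d on the translation s is
   strict by (D1); hence v(b_0) does not change. *)
Lemma eisenstein_dumas_center B : eisenstein_dumas v n B ->
  eisenstein_dumas v n (B \Po ('X + (- (B`_n.-1 / (n%:R * B`_n)))%:P)).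
Proof.
have n_gt0 := ltnW n_gt1.
move=> /eisenstein_dumasP[sB [g [d [v0 vn D1 D2]]]]; set s := - _.
have ge_s : s \in vmul_ge v n d.
  (* (D2) at i = n - 1 bounds n v(b_(n-1)) by n g - (n - 1) d; removing n v(n b_n) = n (0 + (g - d))
     leaves d. *)
  have -> : d = (g *+ n - d *+ n.-1) + ((- (0 + (g - d))) *+ n).
    rewrite add0r opprB mulrnBl addrC addrA subrK -mulrnBr ?leq_pred //.
    by rewrite -[X in (X - _)%N](prednK n_gt0) subSnn.
  rewrite unfold_in /vmul_ge Defs.valN.
  apply: vmul_geM; first by apply: D2; apply: leq_pred.
  by apply: vmul_ge_Some; apply: valuationV; rewrite Defs.valM vn0 vn.
have gt_s : s \in vmul_gt v n d.
  move: ge_s; rewrite !unfold_in /vmul_ge /vmul_gt.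
  case vs : (v s) => [h|] //=; rewrite lt_neqAle => ->; rewrite andbT.
  (* Equality d = n h is excluded by (D1) for k = n, which is allowed since n > 1. *)
  by apply/eqP; apply: D1.
apply/eisenstein_dumasP; split; first exact: size_comp_XaddC.
exists g, d; split=> // [||i le_in].
- rewrite (coef_comp_XaddC _ _ sB) big_ord_recl subn0 bin0 mulr1n expr0 mulr1.
  apply: (valD_gt (n := n) v0).
  elim/big_ind: _ => [||j _]; [exact: vmul_gt0|by move=> *; apply: vmul_gtD|].
  rewrite bin0 subn0 mulr1n mulrC.
  (* Here [bump 0 j] is j + 1: the strict bound (j + 1) d for s^(j+1) and the bound n g - (j + 1) d
     for b_(j+1) add up to a strict bound n g. *)
  rewrite -[g *+ n](subrK (d *+ bump 0 j)) addrC.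
  apply: vmul_gtM; first exact: vmul_gtX.
  by apply: D2; exact: ltn_ord j.
- by rewrite (comp_XaddC_lead _ sB).
- rewrite (coef_comp_XaddC _ _ sB).
  elim/big_ind: _ => [||j _]; [exact: vmul_ge0|by move=> *; apply: vmul_geD|].
  have [le_ij|lt_ji] := leqP i j; last first.
    by rewrite bin_small // mulr0n mulr0 vmul_ge0.
  have -> : g *+ n - d *+ i = (g *+ n - d *+ j) + d *+ (j - i).
    by rewrite mulrnBr // addrA subrK.
  by rewrite vmul_geM ?vmul_geMn ?vmul_geX // D2 // -ltnS.
Qed.

(** Translation by s adds n b_n s to b_(n-1). Division by n is legitimate in K, since v(n) is
    finite. *)
Lemma sublead_center B : (size B <= n.+1)%N -> B`_n != 0 ->
  (B \Po ('X + (- (B`_n.-1 / (n%:R * B`_n)))%:P))`_n.-1 = 0.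
Proof.
move=> sB Bn0; have n0 : n%:R != 0 :> K.
  by apply: contra_eq_neq vn0 => ->; rewrite Defs.val0.
by rewrite (comp_XaddC_sublead _ (ltnW n_gt1) sB); field; rewrite n0 Bn0.
Qed.

(** The barycentre of the roots moves along with a translation, so recentring forgets any earlier
    translation. *)
Lemma transform_U_comp A r : (size A <= n.+1)%N -> A`_n != 0 ->
  let C := A \Po ('X + r%:P) in
  C \Po ('X + (- (C`_n.-1 / (n%:R * C`_n)))%:P) = transform_U n A.
Proof.
move=> sA An0 /=.
have n0 : n%:R != 0 :> K by apply: contra_eq_neq vn0 => ->; rewrite Defs.val0.
rewrite -comp_polyA comp_polyD comp_polyX comp_polyC.
rewrite (comp_XaddC_lead _ sA) (comp_XaddC_sublead _ (ltnW n_gt1) sA).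
rewrite /transform_U; congr (_ \Po _).
rewrite -addrA -rmorphD -rmorphN /=; congr (_ + _%:P).
by rewrite -[r *+ n]mulr_natr; field; rewrite n0 An0.
Qed.

Lemma eisenstein_dumas_transform_U A r : (size A <= n.+1)%N ->
  eisenstein_dumas v n (A \Po ('X + r%:P)) ->
  eisenstein_dumas v n (transform_U n A).
Proof.
move=> sA edA; have := eisenstein_dumas_center edA.
rewrite transform_U_comp //.
by have [_] := eisenstein_dumas_neq0 edA; rewrite comp_XaddC_lead.
Qed.

End EisensteinDumas.

(** * Normal forms of an orbit element according to the image of oo *)

Section Polar.
Variables (K : fieldType) (G : orderedZmodType) (v : valuation K G) (n : nat).
Hypotheses (n_gt1 : (1 < n)%N) (vn0 : v n%:R = Some 0).
Implicit Types (A B : {poly K}) (a b c d e t : K).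

(** The given polynomial is d^n A((a x + b)/d); replacing x by (d/a) x and dividing by d^n leaves a
    translate of A. *)
Lemma eisenstein_dumas_affine A a b d : (size A <= n.+1)%N ->
    a != 0 -> d != 0 ->
    eisenstein_dumas v n (homogenization n A (a%:P * 'X + b%:P) d%:P) ->
  eisenstein_dumas v n (A \Po ('X + (b / d)%:P)).
Proof.
move=> sA a0 d0; apply: (@eisenstein_dumas_scale _ _ _ _ _ _ (d ^- n) (d / a)).
- by rewrite invr_eq0 expf_eq0 (negPf d0) andbF.
- by rewrite mulf_eq0 invr_eq0 negb_or d0.
- exact: size_comp_XaddC.
move=> k le_kn; rewrite (coef_comp_XaddC _ _ sA) coef_sum mulr_sumr.
apply: eq_bigr => i _; rewrite coefZ -rmorphXn /= coefMC coef_linear_exp.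
have [lt_ik|le_ki] := ltnP i k.
  by rewrite bin_small // !mulr0n !(mul0r, mulr0).
rewrite !(mulrnAr, mulrnAl) !expr_div_n; congr (_ *+ _).
have -> : d ^+ n = d ^+ (n - i) * (d ^+ (i - k) * d ^+ k).
  by rewrite -!exprD subnK // subnK // -ltnS.
by field; rewrite !expf_neq0.
Qed.

(** Only the terms i = 0 and i = 1 reach degree n - 1. For c and A'(0) nonzero, b_(n-1) = 0 says
    that e = d (- n A(0) / A'(0)): the image e/d of 0 is the polar point of 0. *)
Lemma coef_homogenizationC_top A e c d :
  let B := homogenization n A e%:P (c%:P * 'X + d%:P) in
  B`_n = A`_0 * c ^+ n /\
  B`_n.-1 = c ^+ n.-1 * (A`_0 * d *+ n + A`_1 * e).
Proof.
have n_gt0 := ltnW n_gt1; split.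
  rewrite coef_homogenizationC big_ord_recl big1 ?addr0 => [|i _].
    by rewrite subn0 subnn binn !mulr1 mulr1n.
  by rewrite bin_small ?mulr0 // ltn_subrL n_gt0.
case: (n) n_gt1 => [|[|m]] // _.
rewrite coef_homogenizationC 2!big_ord_recl big1 ?addr0 => [|i _].
  rewrite subn0 (_ : (m.+2 - lift ord0 ord0)%N = m.+1) // subSnn subnn.
  rewrite binn binSn /=.
  by ring.
by rewrite bin_small ?mulr0 // !subSS ltnS leq_subr.
Qed.

(* With A in place of A(x + t), the point phi(t) - t is - n A(0) / A'(0); it
   is the point at infinity when A'(0) = 0. *)
Lemma eisenstein_dumas_polar A e c d : (size A <= n.+1)%N ->
    e != 0 -> c != 0 ->
    let B := homogenization n A e%:P (c%:P * 'X + d%:P) in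
    B`_n.-1 = 0 -> eisenstein_dumas v n B ->
  if A`_1 == 0 then eisenstein_dumas v n A
  else eisenstein_dumas v n
         (homogenization n A (- (n%:R * (A`_0 / A`_1)))%:P ('X + 1)).
Proof.
move=> sA e0 c0 B Bn1 edB; have [Bn Bn1E] := coef_homogenizationC_top A e c d.
have n0 : n%:R != 0 :> K by apply: contra_eq_neq vn0 => ->; rewrite Defs.val0.
have A0 : A`_0 != 0.
  have [_] := eisenstein_dumas_neq0 edB.
  by rewrite Bn; apply: contraNneq => ->; rewrite mul0r.
move/eqP: Bn1; rewrite Bn1E mulf_eq0 expf_eq0 (negPf c0) andbF /= => /eqP de.
case: eqVneq => [A1|A1].
  have d0 : d = 0.
    move/eqP: de; rewrite A1 mul0r addr0 -mulr_natr !mulf_eq0.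
    by rewrite (negPf A0) (negPf n0) orbF => /eqP.
  (* With d = 0, B is the sum of the A_i e^i (c x)^(n-i), so its reversal C is A up to scaling. *)
  pose C := \poly_(i < n.+1) B`_(n - i).
  have edC : eisenstein_dumas v n C.
    apply: eisenstein_dumas_rev edB; first exact: size_poly.
    by move=> i le_in; rewrite coef_poly ltnS le_in.
  apply: (@eisenstein_dumas_scale _ _ _ _ C _ (c ^- n) (c / e)) edC => //.
  - by rewrite invr_eq0 expf_eq0 (negPf c0) andbF.
  - by rewrite mulf_eq0 invr_eq0 negb_or c0.
  move=> i le_in; rewrite coef_poly ltnS le_in /B coef_homogenizationC.
  (* Only j = i contributes: for j > i the binomial coefficient is 0, and for j < i there is a
     positive power of d = 0. *)
  rewrite (bigD1 (Ordinal (le_in : (i < n.+1)%N))) //= big1 ?addr0 => [|j ne_ji].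
    rewrite subnn binn d0 expr0 mulr1n expr_div_n.
    have -> : c ^+ n = c ^+ i * c ^+ (n - i) by rewrite -exprD subnKC.
    by field; rewrite !expf_neq0.
  have [lt_ij|le_ji] := ltnP i j.
    by rewrite bin_small ?mulr0 // ltn_sub2l // (leq_trans lt_ij) // -ltnS.
  have lt_ji : (j < i)%N by rewrite ltn_neqAle le_ji andbT.
  rewrite d0 expr0n subn_eq0 leqNgt ltn_sub2l ?(leq_trans lt_ji) //=.
  by rewrite mulr0 mul0rn mulr0.
have d0 : d != 0.
  apply: contra_neq A1 => d0; move/eqP: de.
  by rewrite d0 mulr0 mul0rn add0r mulf_eq0 (negPf e0) orbF => /eqP.
(* Now d is nonzero and e/d is the polar point f. *)
set f := - _; have eE : e = f * d.
  apply: (mulfI A1); apply/eqP; rewrite -subr_eq0 -[X in _ == X]de; apply/eqP.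
  by rewrite /f; field.
have -> : 'X + 1 = 1%:P * 'X + 1%:P :> {poly K} by rewrite mul1r.
(* Replacing x by (d/c) x turns c x + d into d (x + 1), and d^(-n) absorbs the factor d. *)
apply: (@eisenstein_dumas_scale _ _ _ _ B _ (d ^- n) (d / c)) edB => [|||k le_kn].
- by rewrite invr_eq0 expf_eq0 (negPf d0) andbF.
- by rewrite mulf_eq0 invr_eq0 negb_or d0.
- exact: size_homogenizationC.
rewrite /B !coef_homogenizationC mulr_sumr; apply: eq_bigr => i _.
have [lt_ik|le_ki] := ltnP (n - i) k.
  by rewrite bin_small // !mulr0n !mulr0.
rewrite !(mulrnAr, mulrnAl); congr (_ *+ _).
have -> : d ^+ n = d ^+ (n - i - k) * (d ^+ k * d ^+ i).
  by rewrite -!exprD addnA subnK // subnK // -ltnS.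
rewrite [in RHS]eE !expr1n expr_div_n exprMn.
by field; rewrite !expf_neq0.
Qed.

End Polar.

Theorem theorem1p5 (K : fieldType) (G : orderedZmodType) (v : valuation K G)
    (v_nontrivial : nontrivial_valuation v)
    (n : nat) (n_gt1 : (1 < n)%N)
    (A : {poly K}) (degA : size A = n.+1)
    (res_char : forall p : nat, p \in [pchar (residue_field v)] ->
                  ~~ (p %| n)%N)
    (orbA : exists2 B : {poly K}, GL2_orbit n A B & eisenstein_dumas v n B) :
  [\/ eisenstein_dumas v n (transform_U n A),
      A`_0 != 0 /\ eisenstein_dumas v n (transform_L n A)
    | exists2 t : K, A^`().[t] != 0 &
        eisenstein_dumas v n (GL2_act n A (mx22 t (phi n A t) 1 1))].
Proof.
have vn0 := val_natr (ltnW n_gt1) res_char.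
have sA : (size A <= n.+1)%N by rewrite degA.
case: orbA => _ [g + ->]; rewrite /GL2_act.
set a := g 0 0; set b := g 0 1; set c := g 1 0; set d := g 1 1.
have -> : (g \in unitmx) = (a * d - b * c != 0).
  by rewrite unitmxE det_mx2 unitfE.
(* The case c = 0 is g(oo) = oo. *)
have [->|c0] := eqVneq c 0.
  rewrite mulr0 subr0 mulf_eq0 negb_or mul0r add0r => /andP[a0 d0] edB.
  apply: Or31; apply: (eisenstein_dumas_transform_U n_gt1 vn0 sA).
  exact: eisenstein_dumas_affine edB.
move=> det0; set B := homogenization n A _ _ => edB'.
have [_ Bn0] := eisenstein_dumas_neq0 edB'.
have [sB _ _ _] := edB'.
have := sublead_center n_gt1 vn0 sB Bn0.
have {edB'} := eisenstein_dumas_center n_gt1 vn0 edB'.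
set s := - _ => edB Bn1.
(* Here t = g(oo), and e = - det(g) / c is the remainder in a x + b = t (c x + d) + e. *)
pose t := a / c; pose e := b - t * d.
have e0 : e != 0.
  apply: contraNneq det0 => e0.
  have -> : b = t * d by apply/eqP; rewrite -subr_eq0 -/e e0.
  by rewrite /t; apply/eqP; field.
(* Translating A by t moves g(oo) to 0 and leaves the numerator e; the recentring x + s only changes
   d into c s + d. *)
have BE : B \Po ('X + s%:P) =
    homogenization n (A \Po ('X + t%:P)) e%:P (c%:P * 'X + (c * s + d)%:P).
  rewrite -homogenization_shift // homogenization_comp.
  have linearE x y :
      (x%:P * 'X + y%:P) \Po ('X + s%:P) = x%:P * 'X + (x * s + y)%:P.
    rewrite comp_polyD comp_polyM !comp_polyC comp_polyX mulrDr -addrA.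
    by rewrite -rmorphM -rmorphD.
  rewrite !linearE; congr homogenization.
  rewrite mulrDr addrCA mulrA -!rmorphM -rmorphD /=.
  by congr (_%:P * 'X + _%:P); rewrite /e /t; field.
rewrite BE in edB Bn1.
have := eisenstein_dumas_polar n_gt1 vn0 (size_comp_XaddC t sA) e0 c0 Bn1 edB.
(* The two lowest coefficients of A(x + t) are A(t) and A'(t), so the polar dichotomy is on the
   vanishing of A'(t). *)
rewrite coef0_comp_XaddC coef1_comp_XaddC; case: eqVneq => [A't0 edA|A't0 edA].
  by apply: Or31; apply: (eisenstein_dumas_transform_U n_gt1 vn0 sA) edA.
apply: Or33; exists t => //; rewrite /GL2_act !mxE /=.
(* Undoing the translation changes the numerator into t (x + 1) - n A(t)/A'(t) = t x + phi(t). *)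
move: edA; rewrite -homogenization_shift //; congr (eisenstein_dumas v n _).
rewrite polyC1 mul1r mulrDr mulr1 addrCA -rmorphD /=.
congr (homogenization n A (_ + _%:P) _).
by rewrite /phi addrC.
Qed.
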